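(* Let $X\in\{LD,LTD,OLD\}$ and let $G$ be a graph admitting an $X$-set. Then $\gamma_X(M(G))\le 2\gamma_X(G)$.
   Context: All graphs are finite, simple and connected. For a graph $G=(V,E)$ and $x\in V$, $N(x)$ is the open neighbourhood and $N[x]=N(x)\cup\{x\}$. A set $C\subseteq V$ is dominating if $N[x]\cap C\ne\emptyset$ for all $x\in V$, and total-dominating if $N(x)\cap C\neq\emptyset$ for all $x\in V$. $C$ is a locating-dominating set ($LD$-set) if it is dominating and $N(x)\cap C\ne N(y)\cap C$ for all distinct $x,y\in V\setminus C$; a locating total-dominating set ($LTD$-set) if it is total-dominating and $N(x)\cap C\ne N(y)\cap C$ for all distinct $x,y\in V\setminus C$; an open locating-dominating set ($OLD$-set) if it is total-dominating and $N(x)\cap C\neq N(y)\cap C$ for all distinct $x,y\in V$. For $X\in\{LD,LTD,OLD\}$, $\gamma_X(G)$ is the minimum size of an $X$-set of $G$. The Mycielski graph $M(G)$ of $G$ with $V=\{v_1,\dots,v_n\}$ is obtained from $G$ by adding, for each $i$, a new vertex $u_i$ adjacent to every vertex of $N_G(v_i)$, and then adding one further vertex $u$ adjacent to all of $u_1,\dots,u_n$ (and to nothing else). *)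

(* Defs.v *)
From HB Require Import structures.
From mathcomp Require Import all_boot.

Set Implicit Arguments.
Unset Strict Implicit.
Unset Printing Implicit Defensive.

Record sgraph := SGraph {
  vertex :> finType;
  adj : rel vertex;
  adj_sym : symmetric adj;
  adj_irr : irreflexive adj
}.

(* The graph without vertices is not connected. *)
Definition connected_graph (G : sgraph) : Prop :=
  0 < #|G| /\ forall x y : G, connect (@adj G) x y.

Section Domination.
Variable G : sgraph.
Implicit Types (x y : G) (C : {set G}).

Definition nbh x : {set G} := [set y | adj x y].
Definition cnbh x : {set G} := x |: nbh x.

Definition dominating C : bool := [forall x, cnbh x :&: C != set0].
Definition total_dominating C : bool := [forall x, nbh x :&: C != set0].

Definition separates (A C : {set G}) : bool :=
  [forall x in A, forall y in A,
    (x != y) ==> (nbh x :&: C != nbh y :&: C)].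

Definition LD_set C : bool := dominating C && separates (~: C) C.
Definition LTD_set C : bool := total_dominating C && separates (~: C) C.
Definition OLD_set C : bool := total_dominating C && separates setT C.
End Domination.

Variant code := LD | LTD | OLD.

Definition code_set (X : code) (G : sgraph) : pred {set G} :=
  match X with
  | LD => @LD_set G
  | LTD => @LTD_set G
  | OLD => @OLD_set G
  end.

Definition admits (X : code) (G : sgraph) : Prop :=
  exists C : {set G}, code_set X C.

(* Meaningful only under [admits X G]; otherwise the value is the junk #|G|. *)
Definition gamma (X : code) (G : sgraph) : nat :=
  #|[arg min_(C < [set: G] | code_set X C) #|C|]|.

Lemma gammaP (X : code) (G : sgraph) : admits X G ->
  (exists2 C : {set G}, code_set X C & #|C| = gamma X G) /\
  (forall C : {set G}, code_set X C -> gamma X G <= #|C|).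
Proof.
have full (C : {set G}) : code_set X C -> code_set X [set: G].
  have sep0 : separates (~: [set: G]) [set: G].
    by apply/forall_inP => x; rewrite !inE.
  have mono (N : G -> {set G}) : [forall x, N x :&: C != set0] ->
      [forall x, N x :&: [set: G] != set0].
    move=> /forallP h; apply/forallP => x; rewrite setIT.
    by apply: contraNneq (h x) => ->; rewrite set0I.
  case: X => /andP[d s]; apply/andP; split; rewrite ?sep0 //; try exact: mono d.
  apply/forall_inP => x xT; apply/forall_inP => y yT; apply/implyP => nxy.
  rewrite !setIT; have /implyP/(_ nxy) := forall_inP (forall_inP s x xT) y yT.
  by apply: contraNneq => ->.
case=> C0 /full fT; rewrite /gamma; case: arg_minnP => // C hC minC.
by split=> //; exists C.
Qed.

Section Mycielski.
Variable G : sgraph.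

(* Some (inl v_i) is v_i, Some (inr v_i) is u_i and None is u. *)
Definition mycielski_adj : rel (option (G + G)) := fun a b =>
  match a, b with
  | Some (inl x), Some (inl y) => adj x y
  | Some (inl x), Some (inr y) => adj x y
  | Some (inr x), Some (inl y) => adj x y
  | Some (inr _), None => true
  | None, Some (inr _) => true
  | _, _ => false
  end.

Lemma mycielski_sym : symmetric mycielski_adj.
Proof. by case=> [[x|x]|] [[y|y]|] //=; rewrite adj_sym. Qed.

Lemma mycielski_irr : irreflexive mycielski_adj.
Proof. by case=> [[x|x]|] //=; rewrite adj_irr. Qed.

Definition mycielski : sgraph := SGraph mycielski_sym mycielski_irr.
End Mycielski.

(* Main.v *)
Require Import Defs.
From mathcomp Require Import all_boot.

(** If [C] is an [X]-set of [G], then the vertices [v_i] and [u_i] with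
    [v_i] in [C] form an [X]-set of [M(G)].  The trace of this set on [N(v_i)]
    is two copies of [N(v_i) :&: C], on [N(u_i)] only the first copy, and on
    [N(u)] a second copy of [C]; when [N(v_i) :&: C] is nonempty these three
    types differ, and within a type the traces differ as they do in [G]. *)

Lemma nbhI_neq0P (G : sgraph) (C : {set G}) (x : G) :
  reflect (exists2 z, z \in C & adj x z) (nbh x :&: C != set0).
Proof.
apply: (iffP (set0Pn _)) => [[z]|[z zC xz]]; first by rewrite !inE => /andP[]; exists z.
by exists z; rewrite !inE xz.
Qed.

Lemma nbhI_eq (G : sgraph) (C : {set G}) (x y : G) :
  nbh x :&: C = nbh y :&: C <-> {in C, adj x =1 adj y}.
Proof.
split=> [/setP e z zC|e]; first by have := e z; rewrite !inE zC !andbT.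
by apply/setP => z; rewrite !inE; case: (boolP (z \in C)) => [/e ->|]; rewrite ?andbF.
Qed.

(** Contrapositive form: whether two vertices agree can then be tested by evaluating the adjacency
    relation at single elements of [C]. *)
Lemma separatesP (G : sgraph) (A C : {set G}) :
  reflect {in A &, forall x y, {in C, adj x =1 adj y} -> x = y} (separates A C).
Proof.
apply: (iffP forall_inP) => [h x y xA yA e|h x xA].
  apply/eqP; apply: contraT => nxy.
  have /implyP/(_ nxy)/eqP[] := forall_inP (h x xA) y yA.
  exact/nbhI_eq.
apply/forall_inP => y yA; apply/implyP; apply: contraNN => /eqP/nbhI_eq.
by move=> /(h x y xA yA)/eqP.
Qed.

(** A vertex of [C] dominates itself. This brings [LD] to the open neighbourhood form of the other
    two codes, restricted to vertices outside [C]. *)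
Lemma dominatingP (G : sgraph) (C : {set G}) :
  reflect (forall x, x \notin C -> nbh x :&: C != set0) (dominating C).
Proof.
apply: (iffP forallP) => [h x xC|h x].
  have /set0Pn[z] := h x; rewrite !inE => /andP[/predU1P[->|xz] zC].
    by rewrite zC in xC.
  by apply/nbhI_neq0P; exists z.
case: (boolP (x \in C)) => [xC|/h/nbhI_neq0P[z zC xz]]; apply/set0Pn.
  by exists x; rewrite !inE eqxx.
by exists z; rewrite !inE xz orbT.
Qed.

Section MycielskiDouble.
Variable G : sgraph.
Implicit Types (A C : {set G}) (x : G) (a : mycielski G).

Definition mycielski_double C : {set mycielski G} :=
  [set Some (inl x) | x in C] :|: [set Some (inr x) | x in C].

Lemma mem_mycielski_double C a : a \in mycielski_double C =
  match a with Some (inl x) | Some (inr x) => x \in C | None => false end.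
Proof.
have inj1 : injective (fun x => Some (inl x) : mycielski G) by move=> ? ? [].
have inj2 : injective (fun x => Some (inr x) : mycielski G) by move=> ? ? [].
rewrite inE; case: a => [[x|x]|].
- by rewrite (mem_imset _ _ inj1) orbC; case: imsetP => // -[].
- by rewrite (mem_imset _ _ inj2); case: imsetP => // -[].
- by case: imsetP => [[]//|_]; case: imsetP => // -[].
Qed.

Lemma card_mycielski_double C : #|mycielski_double C| <= 2 * #|C|.
Proof.
rewrite mul2n -addnn; apply: leq_trans (leq_card_setU _ _) _.
by apply: leq_add; apply: leq_imset_card.
Qed.

Lemma mycielski_double_nbh C a : C != set0 ->
  (forall x, a = Some (inl x) \/ a = Some (inr x) -> nbh x :&: C != set0) ->
  nbh a :&: mycielski_double C != set0.
Proof.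
move=> /set0Pn[z0 z0C] dom; apply/nbhI_neq0P; case: a dom => [[x|x]|] dom.
- have /nbhI_neq0P[z zC xz] := dom x (or_introl erefl).
  by exists (Some (inl z)); rewrite ?mem_mycielski_double.
- have /nbhI_neq0P[z zC xz] := dom x (or_intror erefl).
  by exists (Some (inl z)); rewrite ?mem_mycielski_double.
- by exists (Some (inr z0)); rewrite ?mem_mycielski_double.
Qed.

(** The pair [A], [B] stands for the two complements in the cases [LD] and [LTD], and for the two
    full vertex sets in the case [OLD]. *)
Lemma mycielski_double_separates A C (B : {set mycielski G}) : C != set0 ->
  {in A, forall x, nbh x :&: C != set0} ->
  (forall x, Some (inl x) \in B \/ Some (inr x) \in B -> x \in A) ->
  separates A C -> separates B (mycielski_double C).
Proof.
move=> /set0Pn[z0 z0C] dom BA /separatesP sep; apply/separatesP => a b aB bB e.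
have el z : z \in C -> mycielski_adj a (Some (inl z)) = mycielski_adj b (Some (inl z)).
  by move=> zC; apply: e; rewrite mem_mycielski_double.
have er z : z \in C -> mycielski_adj a (Some (inr z)) = mycielski_adj b (Some (inr z)).
  by move=> zC; apply: e; rewrite mem_mycielski_double.
have inlA x : Some (inl x) \in B -> x \in A by move=> xB; apply: BA; left.
have inrA x : Some (inr x) \in B -> x \in A by move=> xB; apply: BA; right.
have nb x : x \in A -> exists2 z, z \in C & adj x z by move=> /dom/nbhI_neq0P.
case: a b aB bB {e} el er => [[x|x]|] [[y|y]|] //=.
- by move=> /inlA xA /inlA yA el _; rewrite (sep x y).
(* For a neighbour [z] of [x] in [C], the second copy of [z] is adjacent to [v_x] but to no [u_y];
   its first copy is not adjacent to [u]. *)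
- by move=> /inlA/nb[z zC xz] _ _ /(_ z zC); rewrite xz.
- by move=> /inlA/nb[z zC xz] _ /(_ z zC); rewrite xz.
- by move=> _ /inlA/nb[z zC yz] _ /(_ z zC); rewrite yz.
- by move=> /inrA xA /inrA yA el _; rewrite (sep x y).
(* The vertex [u] sees the whole second copy of [C] and [u_x] sees none of it, so any element of [C]
   tells them apart. *)
- by move=> _ _ _ /(_ z0 z0C).
- by move=> _ /inlA/nb[z zC yz] /(_ z zC); rewrite yz.
- by move=> _ _ _ /(_ z0 z0C).
Qed.

Lemma mycielski_double_code_set X C :
  C != set0 -> code_set X C -> code_set X (mycielski_double C).
Proof.
move=> C0.
have notC x : Some (inl x) \in ~: mycielski_double C \/
    Some (inr x) \in ~: mycielski_double C -> x \in ~: C.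
  by rewrite 2![_ \in ~: mycielski_double C]inE !mem_mycielski_double inE => -[].
case: X => /andP[dom sep]; apply/andP; split.
- apply/dominatingP => a aC; apply: mycielski_double_nbh => // x ax.
  apply: (dominatingP _ _ dom); rewrite -in_setC; apply: notC.
  by case: ax => <-; rewrite !in_setC; [left|right].
(* Separation concerns only vertices outside [C], where plain domination already gives a neighbour
   in [C]. *)
- apply: mycielski_double_separates C0 _ notC sep => x; rewrite inE.
  exact: (dominatingP _ _ dom).
- by apply/forallP => a; apply: mycielski_double_nbh => // x _; apply: (forallP dom).
- by apply: mycielski_double_separates C0 _ notC sep => x _; apply: (forallP dom).
- by apply/forallP => a; apply: mycielski_double_nbh => // x _; apply: (forallP dom).
- apply: mycielski_double_separates C0 _ _ sep => x _; last by rewrite inE.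
  exact: (forallP dom).
Qed.

End MycielskiDouble.

(** The empty set meets no neighbourhood, so it fails at any vertex of [G]. *)
Lemma code_set_neq0 X (G : sgraph) (C : {set G}) :
  0 < #|G| -> code_set X C -> C != set0.
Proof.
move=> /card_gt0P[x _]; apply: contraTneq => ->.
by case: X; rewrite negb_and; apply/orP; left; apply/forallPn; exists x;
  rewrite setI0 eqxx.
Qed.

Theorem theorem3 (X : code) (G : sgraph) :
  connected_graph G -> admits X G ->
  admits X (mycielski G) /\ gamma X (mycielski G) <= 2 * gamma X G.
Proof.
move=> [G0 _] /gammaP[[C XC <-] _].
have XD := mycielski_double_code_set _ _ _ (code_set_neq0 _ _ _ G0 XC) XC.
(* Existence comes first: it rules out the default value of [gamma], making it a true minimum. *)
have adm : admits X (mycielski G) by exists (mycielski_double G C).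
split=> //; have [_ minD] := gammaP adm.
exact: leq_trans (minD _ XD) (card_mycielski_double _ _).
Qed.
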